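(* Let $G$ be an analytic topological group which is not $\sigma$-bounded. Then $\mathrm{cf}^\ast_g(G)\leq \mathfrak b(\mathcal L)$ for every ultrafilter $\mathcal L$ on $\omega$ which is not coherent to any $Q$-point.
   Context: A metrizable space is analytic if it is a continuous image of $\omega^\omega$ (with the product topology); a topological group is analytic if its underlying topological space is. Let $1$ be the unit of $G$. A subset $B\subset G$ is totally bounded if for every open neighborhood $U$ of $1$ there is a finite $F\subset G$ with $B\subset FU\cap UF$; $B$ is $\sigma$-bounded if it is a countable union of totally bounded subsets. $\mathrm{cf}^\ast_g(G)$ is the minimal length $\lambda$ of an increasing (with respect to inclusion) chain $\langle G_i:i<\lambda\rangle$ of proper subgroups of $G$ such that $G=\bigcup_{i<\lambda}G_i$ and every $\sigma$-bounded subset $H$ of $G$ is contained in some $G_i$. (The asserted inequality includes the existence of such a chain.) All filters are assumed non-principal. For an ultrafilter $\mathcal F$ on $\omega$ and $x,y\in\omega^\omega$, $x\leq_{\mathcal F}y$ means $\{n:x(n)\leq y(n)\}\in\mathcal F$; $\mathfrak b(\mathcal F)$ is the cofinality of the linearly (pre)ordered set $(\omega^\omega,\leq_{\mathcal F})$. Ultrafilters $\mathcal F$ and $\mathcal U$ on $\omega$ are coherent if there is an increasing sequence $\langle k_n:n\in\omega\rangle$ of natural numbers such that for every $I\subset\omega$, $\bigcup_{n\in I}[k_n,k_{n+1})\in\mathcal F$ if and only if $\bigcup_{n\in I}[k_n,k_{n+1})\in\mathcal U$. An ultrafilter $\mathcal L$ is a $Q$-point if for every monotone (nondecreasing) surjection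 $\phi:\omega\to\omega$ there is $L\in\mathcal L$ such that $\phi\restriction L$ is injective. *)

(* Defs.v *)
From HB Require Import structures.
From mathcomp Require Import all_boot all_order all_algebra.
From mathcomp Require Import all_classical all_reals all_analysis.

Set Implicit Arguments.
Unset Strict Implicit.
Unset Printing Implicit Defensive.

Local Open Scope classical_set_scope.

(* Ordinals are represented, up to isomorphism, by well-ordered types;
   [wochoice.well_order] forces [ord_rel] to be the non-strict (reflexive)
   order. *)
Record ordinal_type := OrdinalType {
  ord_carrier :> Type;
  ord_rel : rel ord_carrier;
  ord_relP : wochoice.well_order ord_rel
}.

(* [l] is isomorphic to an initial segment of [k]. *)
Definition ordinal_le (l k : ordinal_type) : Prop :=
  exists f : l -> k,
    (forall i j, ord_rel (f i) (f j) = ord_rel i j) /\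
    (forall i y, ord_rel y (f i) -> exists j, f j = y).

(* Cardinals are the initial ordinals. *)
Definition is_cardinal (k : ordinal_type) : Prop :=
  forall m : ordinal_type, ([set: m] #= [set: k])%card -> ordinal_le k m.

Definition cofinal (T : Type) (le : T -> T -> Prop) (D : set T) : Prop :=
  forall x, exists2 y, D y & le x y.

Definition is_cofinality (T : Type) (le : T -> T -> Prop)
    (k : ordinal_type) : Prop :=
  [/\ is_cardinal k,
      exists2 D : set T, cofinal le D & (D #= [set: k])%card &
      forall D : set T, cofinal le D -> ([set: k] #<= D)%card].

Definition nonprincipal_ultrafilter (F : set_system nat) : Prop :=
  UltraFilter F /\ ~ (exists n, F = principal_filter n).

Definition le_mod (F : set_system nat) (x y : nat -> nat) : Prop :=
  F [set n | (x n <= y n)%N].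

Definition is_b (F : set_system nat) (k : ordinal_type) : Prop :=
  is_cofinality (le_mod F) k.

Definition coherent (F U : set_system nat) : Prop :=
  exists2 k : nat -> nat, {homo k : m n / (m < n)%N} &
    forall I : set nat,
      F (\bigcup_(n in I) [set m | (k n <= m < k n.+1)%N]) <->
      U (\bigcup_(n in I) [set m | (k n <= m < k n.+1)%N]).

Definition q_point (L : set_system nat) : Prop :=
  nonprincipal_ultrafilter L /\
  forall phi : nat -> nat,
    {homo phi : m n / (m <= n)%N} -> range phi = [set: nat] ->
    exists2 A, L A & set_inj A phi.

HB.mixin Record isTopologicalGroup G of Topological G & Group G := {
  mulg_continuous : continuous (fun x : G * G => (x.1 * x.2)%g);
  invg_continuous : continuous (fun x : G => (x^-1)%g)
}.

#[short(type="topologicalGroupType")]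
HB.structure Definition TopologicalGroup :=
  {G of Topological G & Group G & isTopologicalGroup G}.

Definition metrizable (R : realType) (T : topologicalType) : Prop :=
  exists (M : metricType R) (f : T -> M) (g : M -> T),
    [/\ cancel f g, cancel g f, continuous f & continuous g].

(* [{ptws nat -> nat}] carries the product of the (discrete) topologies
   of [nat]. *)
Definition analytic (R : realType) (T : topologicalType) : Prop :=
  metrizable R T /\
  exists2 f : {ptws nat -> nat} -> T, continuous f & range f = [set: T].

Section TopologicalGroup.
Variable G : topologicalGroupType.

Definition totally_bounded_set (B : set G) : Prop :=
  forall U : set G, open U -> U 1%g ->
    exists2 F : set G, finite_set F &
      B `<=` [set (x * y)%g | x in F & y in U] `&`
             [set (y * x)%g | y in U & x in F].

Definition sigma_bounded (B : set G) : Prop :=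
  exists2 C : nat -> set G, forall n, totally_bounded_set (C n) &
    B = \bigcup_n C n.

Definition proper_subgroup (H : set G) : Prop :=
  group_closed (mem H) /\ H <> [set: G].

Definition cfg_chain (l : ordinal_type) (H : l -> set G) : Prop :=
  [/\ forall i, proper_subgroup (H i),
      forall i j, ord_rel i j -> H i `<=` H j,
      \bigcup_i H i = [set: G] &
      forall B, sigma_bounded B -> exists i, B `<=` H i].

Definition is_cfg (l : ordinal_type) : Prop :=
  (exists H : l -> set G, cfg_chain H) /\
  forall (m : ordinal_type) (H : m -> set G), cfg_chain H -> ordinal_le l m.

End TopologicalGroup.

(* Main.v *)
Require Import Defs.
From mathcomp Require Import all_boot all_order all_algebra.
From mathcomp Require Import all_classical all_reals all_analysis.

Import Order.TTheory GRing.Theory Num.Theory.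

Local Open Scope classical_set_scope.

(** Fix a decreasing base [V n] of closed neighbourhoods of the unit of [G] and a
    dense sequence [g i], and let [K n k] be the set of the [x] such that [x] and
    its inverse both lie in one of the translates [g i * V n] with [i <= k]. A set
    is totally bounded when, for some function [h], it is contained in [K n (h n)]
    for every [n]. For an ultrafilter [L] put

      E h = { x | x lies in K n (h n) for L-many n }.

    The set [E h] grows with [h] modulo [L], the sets [E h] cover [G], and every
    sigma-bounded set lies in one of them. Two facts make a chain of proper
    subgroups out of them.

    - [E h] is never all of [G] ([two_branches], [ultra_bounded_proper]). Present
      [G] as a continuous image of the Baire space. Since [G] is not sigma-bounded,
      some finite sequences are large, in the sense that the image of their cylinder
      is not sigma-bounded, and large sequences can be extended so as to leave
      [K n v] for arbitrarily large [v]. Extending two branches in turn, one gets two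
      points of [G] such that, at almost every [n], one of them is outside
      [K n (h n)]; they cannot both be in [E h].

    - The subgroup generated by [E h] is contained in some [E h']
      ([subgroup_ultra_bounded]). If [x = g i * v] and [y = g j * w], then [x * y] is
      close to [g i * g j] as soon as [v] is small after conjugation by [g j]. Thus
      a bound for [y] at a precision [a] has to be combined with a bound for [x] at
      a precision [b] that is much larger, depending on the bound for [y] at [a]. If
      [L] is not coherent to a Q-point, then every set in [L] has, near most of its
      points [n], two points [a] and [b] which are far enough apart, but lie below a
      bound that depends on [n] only ([incoherent_next_point]); this gives a single
      function bounding the products of two elements of [E h]. Iterating and
      diagonalizing bounds the generated subgroup.

    Now enumerate a cofinal family modulo [L] in the length [b] of the cofinality of
    [L]. Every initial segment of the family is bounded, as it is too short to be
    cofinal and the order is total. The subgroups generated by the sets [E d], for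
    [d] in an initial segment, are therefore proper and form the required chain of
    length [b]. That the two cofinalities exist and can be compared rests on the
    fact that every nonempty class of ordinals has a least member
    ([ordinal_least]). *)

(** * Well-orders and their comparison *)

(** The strict order of an ordinal. *)
Definition ord_lt (k : ordinal_type) (i j : k) : Prop := ~ ord_rel j i.

Lemma ord_least (k : ordinal_type) (A : set k) :
  A !=set0 -> exists2 a, A a & forall b, A b -> ord_rel a b.
Proof.
move=> [x Ax]; have [|z [[/asboolP Az lb] _]] := @ord_relP k [pred x | `[< A x >]].
  by exists x; apply/asboolP.
by exists z => // b Ab; apply: lb; apply/asboolP.
Qed.

Lemma ord_refl (k : ordinal_type) (i : k) : ord_rel i i.
Proof. by have [|a -> ] := @ord_least k [set i]; [exists i | exact]. Qed.

Lemma ord_total (k : ordinal_type) (i j : k) : ord_rel i j \/ ord_rel j i.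
Proof.
have [|a] := @ord_least k [set i; j]; first by exists i; left.
by move=> [] -> lb; [left | right]; apply: lb; [right | left].
Qed.

(** Minima are required to be unique, which gives antisymmetry. *)
Lemma ord_anti (k : ordinal_type) (i j : k) : ord_rel i j -> ord_rel j i -> i = j.
Proof.
move=> ij ji.
have [|z [_ uz]] := @ord_relP k [pred x | `[< x = i \/ x = j >]].
  by exists i; apply/asboolP; left.
have zi : z = i.
  apply: uz; split; first by apply/asboolP; left.
  by move=> b /asboolP[->|->] //; exact: ord_refl.
rewrite -zi; apply: uz; split; first by apply/asboolP; right.
by move=> b /asboolP[->|->] //; exact: ord_refl.
Qed.

Lemma ord_trans (k : ordinal_type) (i j l : k) :
  ord_rel i j -> ord_rel j l -> ord_rel i l.
Proof.
move=> ij jl; have [|a Aa lb] := @ord_least k [set x | x = i \/ x = j \/ x = l].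
  by exists i; left.
have [ai aj al] : [/\ ord_rel a i, ord_rel a j & ord_rel a l].
  by split; apply: lb; rewrite /=; auto.
case: Aa => [<- //|[ea|ea]]; subst a.
  by rewrite (ord_anti _ _ _ ij ai).
by rewrite (ord_anti _ _ _ jl aj) in ij *.
Qed.

Lemma ord_ltW (k : ordinal_type) (i j : k) : ord_lt k i j -> ord_rel i j.
Proof. by move=> ij; case: (ord_total k i j). Qed.

Lemma ord_lt_le_trans (k : ordinal_type) (i j l : k) :
  ord_lt k i j -> ord_rel j l -> ord_lt k i l.
Proof. by move=> ij jl li; apply: ij; exact: ord_trans jl li. Qed.

Lemma ord_le_ltVeq (k : ordinal_type) (i j : k) :
  ord_rel i j -> ord_lt k i j \/ i = j.
Proof.
move=> ij; have [ji|] := pselect (ord_rel j i); last by left.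
by right; exact: ord_anti.
Qed.

(** A relation between two ordinals relating only points whose initial segments
    it matches. *)
Definition ord_bisim (k m : ordinal_type) (R : k -> m -> Prop) : Prop :=
  forall i j, R i j ->
    (forall i', ord_lt k i' i -> exists2 j', ord_lt m j' j & R i' j') /\
    (forall j', ord_lt m j' j -> exists2 i', ord_lt k i' i & R i' j').

(** [i] and [j] have the same rank. *)
Definition same_rank (k m : ordinal_type) (i : k) (j : m) : Prop :=
  exists2 R, ord_bisim k m R & R i j.

Lemma same_rank_bisim (k m : ordinal_type) : ord_bisim k m (same_rank k m).
Proof.
move=> i j [R bR Rij]; have [R1 R2] := bR i j Rij.
by split=> [i' /R1[j' jj Rj]|j' /R2[i' ii Ri]]; [exists j'|exists i'] => //; exists R.
Qed.

Lemma same_rankC (k m : ordinal_type) (i : k) (j : m) :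
  same_rank k m i j -> same_rank m k j i.
Proof.
move=> [R bR Rij]; exists (fun j i => R i j) => // a b /bR[R1 R2].
by split.
Qed.

Lemma same_rank_inj (k m : ordinal_type) (i i' : k) (j : m) :
  same_rank k m i j -> same_rank k m i' j -> i = i'.
Proof.
(* Of the failures [i1 < i2] over a common [y], one with least [y] yields
   another with a smaller [y]. *)
suff no y i1 i2 : ord_lt k i1 i2 ->
    same_rank k m i1 y -> same_rank k m i2 y -> False.
  move=> h h'; have [/ord_le_ltVeq[l|//]|/ord_le_ltVeq[l|//]] := ord_total k i i'.
    by have := no _ _ _ l h h'.
  by have := no _ _ _ l h' h.
move=> l h1 h2.
have [|z [a [b [ab az bz]]] zmin] := @ord_least m [set y | exists a b,
  [/\ ord_lt k a b, same_rank k m a y & same_rank k m b y]]; first by exists y, i1, i2.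
have [/(_ _ ab)[z' zz' az'] _] := same_rank_bisim _ _ _ _ bz.
have [_ /(_ _ zz')[c ca cz']] := same_rank_bisim _ _ _ _ az.
by apply: zz'; apply: zmin; exists c, a.
Qed.

Lemma same_rank_mono (k m : ordinal_type) (i i' : k) (j j' : m) :
  same_rank k m i j -> same_rank k m i' j' -> ord_rel j j' = ord_rel i i'.
Proof.
suff imp (k1 m1 : ordinal_type) (a a' : k1) (b b' : m1) :
    same_rank k1 m1 a b -> same_rank k1 m1 a' b' -> ord_rel a a' -> ord_rel b b'.
  move=> h h'; apply/idP/idP; last exact: imp.
  by apply: imp; exact: same_rankC.
move=> h h' /ord_le_ltVeq[l|e]; last first.
  subst a'; rewrite (same_rank_inj _ _ _ _ _ (same_rankC _ _ _ _ h)
    (same_rankC _ _ _ _ h')); exact: ord_refl.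
have [/(_ _ l)[c cb hc] _] := same_rank_bisim _ _ _ _ h'.
rewrite (same_rank_inj _ _ _ _ _ (same_rankC _ _ _ _ h) (same_rankC _ _ _ _ hc)).
exact: ord_ltW.
Qed.

Lemma same_rank_total_le (k m : ordinal_type) :
  (forall i : k, exists j : m, same_rank k m i j) -> ordinal_le k m.
Proof.
move=> /choice[f fP]; exists f; split=> [i j|i y /ord_le_ltVeq[l|->]].
- exact: same_rank_mono.
- have [_ /(_ _ l)[j _ jy]] := same_rank_bisim _ _ _ _ (fP i).
  by exists j; exact: same_rank_inj (same_rankC _ _ _ _ (fP j)) (same_rankC _ _ _ _ jy).
- by exists i.
Qed.

Lemma ordinal_le_total (k m : ordinal_type) : ordinal_le k m \/ ordinal_le m k.
Proof.
have [|nk] := pselect (forall i, exists j, same_rank k m i j).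
  by left; exact: same_rank_total_le.
have [|nm] := pselect (forall j, exists i, same_rank m k j i).
  by right; exact: same_rank_total_le.
exfalso.
have [i ni imin] : exists2 i, ~ (exists j, same_rank k m i j) &
    forall b, ~ (exists j, same_rank k m b j) -> ord_rel i b.
  by apply: ord_least; apply: contrapT => H; apply: nk => i;
     apply: contrapT => H'; apply: H; exists i.
have [j nj jmin] : exists2 i, ~ (exists j, same_rank m k i j) &
    forall b, ~ (exists j, same_rank m k b j) -> ord_rel i b.
  by apply: ord_least; apply: contrapT => H; apply: nm => i';
     apply: contrapT => H'; apply: H; exists i'.
(* The least points without a counterpart on either side can be matched. *)
apply: (ni); exists j; exists (fun a b => same_rank k m a b \/ a = i /\ b = j); last by right.
move=> a b [ab|[-> ->]].
  have [B1 B2] := same_rank_bisim _ _ _ _ ab.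
  by split=> [x /B1[y]|x /B2[y]]; exists y => //; left.
split=> [a' l|b' l].
  have [b' ab'] : exists j, same_rank k m a' j by apply: contrapT => /imin.
  exists b'; last by left.
  move=> /ord_le_ltVeq[l'|e]; apply: nj; last by exists a'; subst j; exact: same_rankC.
  by have [_ /(_ _ l')[c _ /same_rankC]] := same_rank_bisim _ _ _ _ ab'; exists c.
have [a' ab'] : exists j, same_rank m k b' j by apply: contrapT => /jmin.
have {}ab' := same_rankC _ _ _ _ ab'.
exists a'; last by left.
move=> /ord_le_ltVeq[l'|e]; last by apply: ni; subst a'; exists b'.
by apply: ni; have [/(_ _ l')[c _ ]] := same_rank_bisim _ _ _ _ ab'; exists c.
Qed.

(** Every nonempty class of ordinals has a member of least length. *)
Lemma ordinal_least (P : ordinal_type -> Prop) (k0 : ordinal_type) : P k0 ->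
  exists2 k, P k & forall m, P m -> ordinal_le k m.
Proof.
move=> Pk0; apply: contrapT => noleast.
(* [seg m f a]: [m] is isomorphic, through [f], to the segment of [k0] below [a]. *)
pose seg (m : ordinal_type) (f : m -> k0) (a : k0) :=
  (forall i j, ord_rel (f i) (f j) = ord_rel i j) /\
  (forall y, ord_lt k0 y a <-> exists i, f i = y).
have proper (k m : ordinal_type) : ~ ordinal_le k m ->
    exists f : m -> k, exists a : k, (forall i j, ord_rel (f i) (f j) = ord_rel i j) /\
      (forall y, ord_lt k y a <-> exists i, f i = y).
  move=> nkm; have [//|[f [fm fi]]] := ordinal_le_total k m.
  exists f; have [|a na amin] := @ord_least k [set y | ~ exists i, f i = y].
    apply: contrapT => H; apply: nkm.
    have /choice[g gK] : forall y, exists i, f i = y.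
      by move=> y; apply: contrapT => H'; apply: H; exists y.
    exists g; split=> [i j|i y _]; first by rewrite -fm !gK.
    exists (f y).
    have e : f (g (f y)) = f y by [].
    by apply: ord_anti; rewrite -fm e; exact: ord_refl.
  exists a; split=> // y; split=> [l|[i <-]].
    by apply: contrapT => /amin.
  by move=> /fi.
have [|a [m [Pm [f [fm fa]]]] amin] := @ord_least k0 [set a | exists m, P m /\
    exists f, seg m f a].
  have [m [Pm nm]] : exists m, P m /\ ~ ordinal_le k0 m.
    apply: contrapT => H; apply: noleast; exists k0 => // m Pm.
    by apply: contrapT => nm; apply: H; exists m.
  by have [f [a [fm fa]]] := proper _ _ nm; exists a, m; split=> //; exists f.
apply: noleast; exists m => // m' Pm'; apply: contrapT => nm.
have [g [b [gm gb]]] := proper _ _ nm.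
have ba : ord_lt k0 (f b) a by apply/fa; exists b.
apply: ba; apply: amin; exists m'; split=> //; exists (f \o g); split=> [i j|y].
  by rewrite /= fm gm.
split=> [yb|[i <-]].
  have /fa[c e] : ord_lt k0 y a.
    by apply: (ord_lt_le_trans _ _ _ _ yb); apply: ord_ltW; apply/fa; exists b.
  subst y; have /gb[i <-] : ord_lt m c b by rewrite /ord_lt -fm.
  by exists i.
by rewrite /ord_lt /= fm; apply/gb; exists i.
Qed.

(** The order induced on a set of points. *)
Definition sub_ord_rel (k : ordinal_type) (A : set k) : rel A :=
  fun i j => ord_rel (val i) (val j).

Lemma sub_ord_relP (k : ordinal_type) (A : set k) :
  wochoice.well_order (sub_ord_rel k A).
Proof.
move=> B [x Bx].
have [|a [y By <-] lb] := @ord_least k [set val y | y in [set y : A | y \in B]].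
  by exists (val x), x.
exists y; split; first by split=> // z Bz; apply: lb; exists z.
move=> z [Bz zlb]; apply: val_inj; apply: ord_anti; last exact: zlb.
by apply: lb; exists z.
Qed.

Definition sub_ordinal (k : ordinal_type) (A : set k) : ordinal_type :=
  OrdinalType (sub_ord_relP k A).

Lemma ord_embedding_ge (k : ordinal_type) (f : k -> k) :
  (forall i j, ord_rel (f i) (f j) = ord_rel i j) -> forall i, ord_rel i (f i).
Proof.
move=> fm i; apply: contrapT => ni.
have [|a na amin] := @ord_least k [set i | ~ ord_rel i (f i)]; first by exists i.
by case: (na); apply: amin; rewrite /= fm.
Qed.

Lemma not_ordinal_le_segment (k : ordinal_type) (a : k) :
  ~ ordinal_le k (sub_ordinal k [set i | ord_lt k i a]).
Proof.
move=> [f [fm _]].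
have /(_ a) := ord_embedding_ge k (fun i => val (f i)) fm.
by have /set_mem := valP (f a).
Qed.

Lemma exists_ordinal (T : choiceType) (A : set T) :
  exists m : ordinal_type, ([set: m] #= A)%card.
Proof.
have [R wR] := wochoice.well_ordering_principle A.
by exists (OrdinalType wR) => /=; exact: card_setT.
Qed.

(** The cofinality of a relation exists; its length moreover embeds in every
    ordinal equinumerous with a cofinal set. *)
Lemma exists_cofinality (T : choiceType) (le : T -> T -> Prop) :
  (forall x, le x x) ->
  exists k : ordinal_type, is_cofinality le k /\
    forall (m : ordinal_type) (D : set T), cofinal le D -> (D #= [set: m])%card ->
      ordinal_le k m.
Proof.
move=> le_refl.
pose P (k : ordinal_type) := exists2 D : set T, cofinal le D & (D #= [set: k])%card.
have [k0 ck0] := exists_ordinal T setT.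
have [|k [D cD Dk] kmin] := ordinal_least P k0.
  by exists setT; [move=> x; exists x | rewrite card_eq_sym].
have kle (m : ordinal_type) D' : cofinal le D' -> (D' #= [set: m])%card -> ordinal_le k m.
  by move=> cD' Dm; apply: kmin; exists D'.
exists k; split=> //; split.
- by move=> m mk; apply: (kle _ D) => //; apply: card_eq_trans Dk _; rewrite card_eq_sym.
- by exists D.
- move=> D' cD'; have [m mD'] := exists_ordinal T D'.
  have [|f [fm _]] := kle m D' cD'; first by rewrite card_eq_sym.
  apply: card_le_trans (_ : ([set: k] #<= [set: m])%card) _; last first.
    by move: mD'; rewrite card_eq_le => /andP[].
  have f_inj : {in [set: k] &, injective f}.
    by move=> i j _ _ e; apply: ord_anti; rewrite -fm e; exact: ord_refl.
  have := inj_card_eq f_inj; rewrite card_eq_sym card_eq_le => /andP[+ _].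
  move=> /card_le_trans; apply; exact: subset_card_le.
Qed.

(** * Ultrafilters not coherent to a Q-point *)

(** The least nondecreasing function above [h]. *)
Definition mono_hull (h : nat -> nat) (n : nat) : nat := \max_(i < n.+1) h i.

Lemma mono_hull_ge (h : nat -> nat) (i n : nat) :
  (i <= n)%N -> (h i <= mono_hull h n)%N.
Proof.
rewrite -ltnS => lin.
exact: (leq_bigmax_cond (F := fun i : 'I_n.+1 => h i) (Ordinal lin)).
Qed.

Lemma block_index (k : nat -> nat) : k 0 = 0 -> {homo k : m n / (m < n)%N} ->
  exists phi : nat -> nat, forall n i, (k i <= n < k i.+1)%N = (phi n == i).
Proof.
move=> k0 kh; have km := leqW_mono (leq_mono kh).
have /choice[phi phiP] : forall n, exists i, (k i <= n < k i.+1)%N.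
  elim=> [|n [i /andP[kin ni]]]; first by exists 0; have := kh 0 1 isT; rewrite k0 => ->.
  have [ni'|] := ltnP n.+1 (k i.+1); first by exists i; rewrite (leq_trans kin).
  by move=> kn; exists i.+1; rewrite kn /= (leq_ltn_trans ni) // kh.
exists phi => n i; apply/idP/eqP => [/andP[ki ik]|<- //].
have /andP[kp pk] := phiP n.
apply/eqP; rewrite eqn_leq -(ltnS (phi n)) -(ltnS i) -(km (phi n)) -(km i).
by rewrite (leq_ltn_trans kp ik) (leq_ltn_trans ki pk).
Qed.

Lemma nonprincipal_cofinite (L : set_system nat) (N : nat) :
  nonprincipal_ultrafilter L -> L [set n | (N <= n)%N].
Proof.
move=> [UL npL]; elim: N => [|N IH]; first by apply: filterS filterT.
have [LN|LN] := in_ultra_setVsetC [set N] UL; last first.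
  by apply: filterS (filterI IH LN) => n [/= Nn /eqP nN]; rewrite ltn_neqAle eq_sym nN.
exfalso; apply: npL; exists N; apply/esym/max_filter => [|A LA].
  exact: principal_filter_proper.
by apply/principal_filterP; have [n [An /= <-]] := filter_ex (filterI LA LN).
Qed.

Lemma fmap_ultra (T U : Type) (f : T -> U) (F : set_system T) :
  UltraFilter F -> UltraFilter (fmap f F).
Proof.
move=> UF; split; first exact: fmap_proper_filter.
move=> G PG FG; rewrite eqEsubset; split=> // A GA.
have [//|nA] := in_ultra_setVsetC (f @^-1` A) UF.
have GnA : G (~` A) by apply: FG.
by have [? []] := filter_ex (filterI GA GnA).
Qed.

(** Every set in an ultrafilter that is not coherent to any Q-point has, near most
    of its points, a further point which is far away, but at a distance bounded
    independently of the set. *)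
Lemma incoherent_next_point (L : set_system nat) :
  nonprincipal_ultrafilter L -> (forall Q, q_point Q -> ~ coherent L Q) ->
  forall H : nat -> nat, exists T : nat -> nat, forall C, L C ->
    L [set n | C n /\ exists2 a, C a & (H n <= a <= T n)%N].
Proof.
move=> hL hcoh H; have [UL _] := hL.
pose k := fix k i := if i is j.+1 then maxn (k j).+1 (mono_hull H (k j)) else 0.
have kS i : (k i < k i.+1)%N by rewrite leq_max leqnn.
have kh : {homo k : m n / (m < n)%N} by apply: homo_ltn kS; exact: ltn_trans.
have km := leq_mono kh.
have k_ge i : (i <= k i)%N by elim: i => // i /leq_ltn_trans; apply; exact: kS.
have [phi phiP] := block_index k erefl kh.
have phik n : (k (phi n) <= n < k (phi n).+1)%N by rewrite phiP.
pose r n := k (phi n).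
have kr n : phi (r n) = phi n by apply/eqP; rewrite -phiP leqnn kS.
(* Pushing the ultrafilter to the left ends of the blocks keeps it coherent. *)
pose Q := fmap r L.
have UQ : UltraFilter Q by exact: fmap_ultra.
have coh : coherent L Q.
  exists k => // I; set B := \bigcup_(n in I) _.
  have BP n : B n <-> I (phi n).
    split=> [[i Ii /=]|Ip]; first by rewrite phiP => /eqP ->.
    by exists (phi n) => //=; rewrite phiP.
  suff -> : Q B = L B by [].
  congr L; apply/seteqP; split=> n /=.
    by rewrite /preimage /= => /BP; rewrite kr => /BP.
  by move/BP => In; apply/BP; rewrite kr.
have npQ : nonprincipal_ultrafilter Q.
  split=> // -[m QE].
  have : Q [set m] by rewrite QE; apply/principal_filterP.
  move=> Lm; have [n [/= <-]] := filter_ex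
    (filterI (Lm : L (r @^-1` [set m])) (nonprincipal_cofinite L (k (phi m).+1) hL)).
  by rewrite kr leqNgt; have /andP[_ ->] := phik n.
have [psi [psih psis ninj]] : exists psi, [/\ {homo psi : m n / (m <= n)%N},
    range psi = [set: nat] & forall A, Q A -> ~ set_inj A psi].
  apply: contrapT => H'; apply: (hcoh Q _ coh); split=> // psi ph ps.
  by apply: contrapT => na; apply: H'; exists psi; split=> // A QA iA; apply: na; exists A.
have /choice[t tP] : forall n, exists t, psi t = (psi (r n)).+1.
  move=> n; have [t _ <-] : range psi (psi (r n)).+1 by rewrite psis.
  by exists t.
exists (fun n => k (t n)) => C LC.
set good := [set n | _].
have [//|Lbad] := in_ultra_setVsetC good UL; exfalso.
have T_ge n a : psi (r a) = psi (r n) -> (a <= k (t n))%N.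
  move=> e; have lt : (r a < t n)%N.
    rewrite ltnNge; apply/negP => /psih; rewrite tP e ltnn => //.
  have /andP[_ /ltnW ak] := phik a; apply: leq_trans ak _; rewrite km.
  exact: leq_ltn_trans (k_ge _) lt.
(* Distinct blocks of equal parity are separated by a whole block. *)
have [b Lb] : exists b, L [set n | odd (phi n) = b].
  have [Lb|Lb] := in_ultra_setVsetC [set n | odd (phi n)] UL; first by exists true.
  by exists false; apply: filterS Lb => n /= /negP/negbTE.
pose D := C `&` ~` good `&` [set n | odd (phi n) = b].
have LD : L D by apply: filterI => //; exact: filterI.
have QD : L (r @^-1` (r @` D)) by apply: filterS LD => n Dn; exists n.
apply: (ninj (r @` D) QD).
have main n n' : D n -> D n' -> (phi n < phi n')%N -> psi (r n) <> psi (r n').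
  move=> [[Cn ng] /= on] [[Cn' _] /= on'] lt e; apply: ng; split=> //; exists n' => //.
  rewrite T_ge // andbT.
  have lt2 : ((phi n).+2 <= phi n')%N.
    rewrite ltn_neqAle lt andbT; apply/eqP => e'.
    by move: on'; rewrite -e' /= on; case: (b).
  have /andP[kn' _] := phik n'; apply: leq_trans kn'.
  apply: (@leq_trans (k (phi n).+2)); last by rewrite km.
  rewrite /= leq_max; apply/orP; right; apply: (@mono_hull_ge H).
  by have /andP[_ /ltnW] := phik n.
move=> _ _ /set_mem[n Dn <-] /set_mem[n' Dn' <-] e.
have [lt|lt|pe] := ltngtP (phi n) (phi n'); last by rewrite /r pe.
  by have := main _ _ Dn Dn' lt e.
by have := main _ _ Dn' Dn lt (esym e).
Qed.

(** * Two branches escaping a function *)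

(** Here [K n k] is thought of as the set of the elements that are, at precision
    [n], within reach of the first [k + 1] members of a dense sequence. *)
Section Escape.
Context (G : Type) (K : nat -> nat -> set G).

(** The sets that are countable unions of sets bounded at every precision. *)
Definition sigma_small (B : set G) : Prop :=
  exists h : nat -> nat -> nat, forall x, B x -> exists i, forall n, K n (h i n) x.

Context (K_anti : forall m n k x, (m <= n)%N -> K n k x -> K m k x).
Context (K_mono : forall n k k' x, (k <= k')%N -> K n k x -> K n k' x).
Context (f : (nat -> nat) -> G).
Context (K_closed : forall n k z, ~ K n k (f z) ->
  exists l, forall z', (forall i, (i < l)%N -> z' i = z i) -> ~ K n k (f z')).

Definition cylinder (s : seq nat) : set (nat -> nat) :=
  [set z | forall i, (i < size s)%N -> z i = nth 0 s i].

(** [s'] is a proper end-extension of [s]. *)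
Definition extends (s s' : seq nat) : Prop :=
  (size s < size s')%N /\ forall i, (i < size s)%N -> nth 0 s' i = nth 0 s i.

Definition large (s : seq nat) : Prop := ~ sigma_small (f @` cylinder s).

(** For every [v], some large extension of [s] forces the image out of [K n v]. *)
Definition splits (s : seq nat) (n : nat) : Prop := forall v,
  exists s', [/\ extends s s', large s' & forall z, cylinder s' z -> ~ K n v (f z)].

(** Otherwise the points of the cylinder all of whose neighbourhoods are large would
    be bounded at every precision from [N] on, hence at every precision. *)
Lemma large_splits (s : seq nat) (N : nat) :
  large s -> exists2 n, (N <= n)%N & splits s n.
Proof.
move=> ls; apply: contrapT => H; apply: ls.
have /choice[v vP] : forall n, exists v, (N <= n)%N -> forall s', extends s s' ->
    large s' -> exists2 z, cylinder s' z & K n v (f z).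
  move=> n; have [Nn|nN] := pselect (N <= n)%N; last by exists 0.
  apply: contrapT => H1; apply: H; exists n => // v.
  apply: contrapT => H2; apply: H1; exists v => _ s' es ls.
  apply: contrapT => H3; apply: H2; exists s'; split=> // z cz Kz.
  by apply: H3; exists z.
have /choice[g gP] : forall t, exists h : nat -> nat -> nat, ~ large t ->
    forall x, (f @` cylinder t) x -> exists i, forall n, K n (h i n) x.
  move=> t; have [lt|/contrapT[h hP]] := pselect (large t); first by exists (fun _ _ => 0).
  by exists h.
(* One function handles the points all of whose neighbourhoods are large; the
   others lie in one of countably many small cylinders. *)
exists (fun i => if unpickle i is Some (Some (t, j)) then g t j
                 else fun n => v (maxn n N)) => _ [z sz <-].
have [[l nl]|al] := pselect (exists l, ~ large (mkseq z l)).
  have [|j jP] := gP _ nl (f z).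
    by exists z => // i; rewrite size_mkseq => il; rewrite nth_mkseq.
  by exists (pickle (Some (mkseq z l, j))) => n; rewrite pickleK.
exists (pickle (@None (seq nat * nat))) => n; rewrite pickleK.
apply: (@K_anti n (maxn n N)); first by rewrite leq_maxl.
apply: contrapT => /K_closed[l lP].
pose l' := maxn l (size s).+1.
have [||| z' cz' Kz'] := vP (maxn n N) _ (mkseq z l').
- by rewrite leq_maxr.
- split; rewrite ?size_mkseq ?leq_maxr // => i il; rewrite nth_mkseq ?sz //.
  by rewrite /l' leq_max leqW ?orbT.
- by apply: contrapT => nl; apply: al; exists l'.
apply: (lP z') Kz' => i il; have il' : (i < l')%N by rewrite /l' leq_max il.
by rewrite cz' ?size_mkseq // nth_mkseq.
Qed.

Lemma extends_limit (c : nat -> seq nat) : (forall j, extends (c j) (c j.+1)) ->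
  exists z, forall j, cylinder (c j) z.
Proof.
move=> ec.
have sz j : (j <= size (c j))%N.
  by elim: j => // j /leq_ltn_trans; apply; have [] := ec j.
have agree j d i : (i < size (c j))%N ->
    (i < size (c (j + d)))%N /\ nth 0 (c (j + d)) i = nth 0 (c j) i.
  move=> il; elim: d => [|d [IH1 IH2]]; first by rewrite addn0.
  have [s1 s2] := ec (j + d); rewrite addnS; split; first exact: ltn_trans s1.
  by rewrite s2.
exists (fun i => nth 0 (c i.+1) i) => j i il.
have [ij|ji] := leqP i.+1 j.
  by rewrite -(subnKC ij); have [|_ ->] := agree i.+1 (j - i.+1) i; first exact: sz.
by rewrite -(subnKC (ltnW ji)); have [//|_ ->] := agree j (i.+1 - j) i.
Qed.

(** Two branches are extended in turn. At a splitting level of one branch, its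
    extension avoids [K] at so large a value that the branch keeps avoiding
    [K m (h m)] up to the splitting level of the other branch. *)
Lemma two_branches : ~ sigma_small (range f) -> forall h : nat -> nat,
  exists z0 z1 N, forall m, (N <= m)%N ->
    ~ K m (h m) (f z0) \/ ~ K m (h m) (f z1).
Proof.
move=> nsm h.
(* A state consists of the branch to be extended next, the other branch, and a
   level at which the former splits. *)
pose valid (t : seq nat * seq nat * nat) :=
  [/\ large t.1.1, large t.1.2 & splits t.1.1 t.2].
pose next (t t' : seq nat * seq nat * nat) := [/\ t'.1.1 = t.1.2, extends t.1.1 t'.1.2,
  (t.2 < t'.2)%N & forall z, cylinder t'.1.2 z ->
    forall m, (t.2 <= m <= t'.2)%N -> ~ K m (h m) (f z)].
have /choice[F FP] : forall t, exists t', valid t -> valid t' /\ next t t'.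
  move=> [[a b] n]; have [[/= la lb sa]|] := pselect (valid (a, b, n)); last first.
    by exists (a, b, n).
  have [n' nn' sb] := large_splits b n.+1 lb.
  have [a' [ea la' a'P]] := sa (mono_hull h n').
  exists (b, a', n') => _; split=> //; split=> //= z za' m /andP[nm mn'] Kz.
  apply: (a'P z za'); apply: (@K_anti n m) => //.
  by apply: K_mono Kz; exact: mono_hull_ge.
have large0 : large [::].
  move=> [g gP]; apply: nsm; exists g => _ [z _ <-]; apply: gP.
  by exists z.
have [n0 _ s0] := large_splits [::] 0 large0.
pose t i := iter i F ([::], [::], n0).
have tv i : valid (t i) by elim: i => // i /FP[].
have tn i : next (t i) (t i.+1) by have [] := FP _ (tv i).
pose a i := (t i).1.1.
have ab i : (t i.+1).1.2 = a i.+2 by rewrite /a; have [-> _ _ _] := tn i.+1.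
have ea i : extends (a i) (a i.+2) by rewrite -ab; have [] := tn i.
have [|z0 z0P] := extends_limit (fun j => a j.*2); first by move=> j; exact: ea.
have [|z1 z1P] := extends_limit (fun j => a j.*2.+1); first by move=> j; exact: ea.
have far i : (i <= (t i).2)%N.
  by elim: i => // i /leq_ltn_trans; apply; have [] := tn i.
exists z0, z1, n0 => m n0m.
have [i im] : exists i, ((t i).2 <= m <= (t i.+1).2)%N.
  suff : forall j, (m <= (t j).2)%N -> exists i, ((t i).2 <= m <= (t i.+1).2)%N.
    by apply; exact: far.
  elim=> [|j IH] mj.
    by exists 0; rewrite [X in (X <= _)%N]/= n0m; have [_ _ /ltnW + _] := tn 0; apply: leq_trans.
  by have [/IH//|/ltnW jm] := leqP m (t j).2; exists j; rewrite jm.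
have avoid z : cylinder (a i.+2) z -> ~ K m (h m) (f z).
  by rewrite -ab => cz; have [_ _ _] := tn i; apply.
have := odd_double_half i; case: (odd i) => /= e.
  by right; apply: avoid; rewrite -e; exact: (z1P (i./2).+1).
by left; apply: avoid; rewrite -e; exact: (z0P (i./2).+1).
Qed.

End Escape.

(** * Subgroups from bounds modulo an ultrafilter *)

(** The elements whose bounds in the filtration [K] are below [h] modulo [L]. *)
Definition ultra_bounded (L : set_system nat) (G : Type) (K : nat -> nat -> set G)
    (h : nat -> nat) : set G := [set x | L [set n | K n (h n) x]].

Section UltraBounded.
Context (L : set_system nat) (L_ultra : nonprincipal_ultrafilter L).
Context (G : groupType) (K : nat -> nat -> set G).
Context (K_anti : forall m n k x, (m <= n)%N -> K n k x -> K m k x).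
Context (K_mono : forall n k k' x, (k <= k')%N -> K n k x -> K n k' x).
Local Notation E := (ultra_bounded L G K).

Lemma ultra_bounded_mono (h h' : nat -> nat) : le_mod L h h' -> E h `<=` E h'.
Proof.
move=> hh' x Ex; have [UL _] := L_ultra.
by apply: filterS (filterI hh' Ex) => n [/= le]; exact: K_mono.
Qed.

Lemma sigma_small_ultra_bounded (B : set G) :
  sigma_small G K B -> exists h, B `<=` E h.
Proof.
move=> [h hP]; have [UL _] := L_ultra.
exists (fun n => \max_(i < n.+1) h i n) => x /hP[i Ki].
apply: filterS (nonprincipal_cofinite L i L_ultra) => n /= ni.
apply: K_mono (Ki n).
by apply: (leq_bigmax_cond (F := fun j : 'I_n.+1 => h j n) (Ordinal (ni : i < n.+1)%N)).
Qed.

(** Of the two branches that escape [h], at most one can be in [E h]. *)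
Lemma ultra_bounded_proper (f : (nat -> nat) -> G) :
  (forall n k z, ~ K n k (f z) ->
    exists l, forall z', (forall i, (i < l)%N -> z' i = z i) -> ~ K n k (f z')) ->
  ~ sigma_small G K (range f) -> forall h, E h <> [set: G].
Proof.
move=> K_closed nsm h ET; have [UL _] := L_ultra.
have [z0 [z1 [N zP]]] := two_branches G K K_anti K_mono f K_closed nsm h.
have E0 : E h (f z0) by rewrite ET.
have E1 : E h (f z1) by rewrite ET.
have [n [[K0 K1] Nn]] := filter_ex
  (filterI (filterI E0 E1) (nonprincipal_cofinite L N L_ultra)).
by case: (zP n Nn).
Qed.

(** What the group operations do to the filtration. To bound a product [x * y] the
    left factor has to be known at a precision [b] that depends on the bound [k]
    for the right factor at precision [a]. Both factors are assumed to be known at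
    both precisions, which makes the condition invariant under passing to the
    inverse of the product. *)
Definition filtered_group : Prop :=
  [/\ forall n, exists k, K n k 1%g,
      forall n k x, K n k x -> K n k x^-1%g &
      exists (p : nat -> nat) (M C : nat -> nat -> nat), forall n a b k q x y,
        (p n <= a)%N -> (M a k <= b)%N -> (k <= q)%N ->
        K a k x -> K a k y -> K b q x -> K b q y -> K n (C n q) (x * y)%g].

Context (K_group : filtered_group).
Context (L_incoherent : forall Q, q_point Q -> ~ coherent L Q).

Lemma ultra_boundedV (h : nat -> nat) (x : G) : E h x -> E h x^-1%g.
Proof.
have [UL _] := L_ultra; have [_ KV _] := K_group.
by apply: filterS => n; exact: KV.
Qed.

Lemma ultra_boundedM (h : nat -> nat) : exists2 h', (forall n, (h n <= h' n)%N) &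
  forall x y, E h x -> E h y -> E h' (x * y)%g.
Proof.
have [UL _] := L_ultra; have [_ _ [p [M [C KM]]]] := K_group.
have [T TP] := incoherent_next_point L L_ultra L_incoherent
  (fun n => maxn (p n) (M n (h n))).
(* The two points found for [n] lie below [T n] and [T (T n)]. *)
pose bnd n := mono_hull h (maxn (T n) (mono_hull T (T n))).
exists (fun n => maxn (h n) (C n (bnd n))) => [n|x y Ex Ey]; first exact: leq_maxl.
have LC : L ([set n | K n (h n) x] `&` [set n | K n (h n) y]) by exact: filterI.
have := TP _ (TP _ LC); apply: filterS => n [[_ _] [a [[xa ya] [b [xb yb] bP]] aP]].
move: aP bP; rewrite !geq_max -andbA => /and3P[pa _ aT] /andP[/andP[_ Mb] bT].
apply: (@K_mono n (C n (bnd n))); first exact: leq_maxr.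
have hb : (h b <= bnd n)%N.
  apply: mono_hull_ge; rewrite leq_max; apply/orP; right.
  by apply: leq_trans bT _; exact: mono_hull_ge.
apply: (KM n a b (h a)) => //.
- by apply: mono_hull_ge; rewrite leq_max aT.
- exact: K_mono xb.
- exact: K_mono yb.
Qed.

Lemma subgroup_ultra_bounded (h : nat -> nat) : exists (h' : nat -> nat) (P : set G),
  [/\ group_closed (mem P), E h `<=` P & P `<=` E h'].
Proof.
have [UL _] := L_ultra; have [K1 _ _] := K_group.
have /choice[e eP] := K1.
have /choice[F FP] : forall g, exists g', (forall n, (g n <= g' n)%N) /\
    forall x y, E g x -> E g y -> E g' (x * y)%g.
  by move=> g; have [g' ? ?] := ultra_boundedM g; exists g'.
(* Iterate the bound for products, and take the diagonal of the iterates. *)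
pose s i := iter i F (fun n => maxn (h n) (e n)).
have s_homo i j n : (i <= j)%N -> (s i n <= s j n)%N.
  move=> /subnKC <-; elim: (j - i) => [|d IH]; first by rewrite addn0.
  by rewrite addnS; apply: leq_trans IH _; have [] := FP (s (i + d)).
have Es i j : (i <= j)%N -> E (s i) `<=` E (s j).
  move=> ij; apply: ultra_bounded_mono; rewrite /le_mod.
  by apply: filterS filterT => n _; exact: s_homo.
exists (fun n => s n n), (\bigcup_i E (s i)); split.
- split.
    rewrite inE; exists 0 => //; apply: filterS filterT => n _ /=.
    by apply: K_mono (eP n); exact: leq_maxr.
  move=> x y; rewrite !inE => -[i _ Ex] [j _ Ey].
  exists (maxn i j).+1 => //; have [_] := FP (s (maxn i j)); apply.
    exact: Es (leq_maxl i j) _ Ex.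
  by apply: ultra_boundedV; exact: Es (leq_maxr i j) _ Ey.
- move=> x Ex; exists 0 => //; apply: ultra_bounded_mono Ex.
  by apply: filterS filterT => n _ /=; exact: leq_maxl.
- move=> x [i _]; apply: ultra_bounded_mono.
  apply: filterS (nonprincipal_cofinite L i L_ultra) => n /=; exact: s_homo.
Qed.

End UltraBounded.

(** The subgroup generated by [A]. *)
Definition generated (G : groupType) (A : set G) : set G :=
  [set x | forall P : set G, group_closed (mem P) -> A `<=` P -> P x].

Lemma generated_closed (G : groupType) (A : set G) : group_closed (mem (generated G A)).
Proof.
split; first by rewrite inE => P [P1 _] _; move: P1; rewrite inE.
move=> x y; rewrite !inE => gx gy P gP AP; have [_ PB] := gP.
by have := PB x y; rewrite !inE; apply; [exact: gx|exact: gy].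
Qed.

Lemma generated_sub (G : groupType) (A : set G) : A `<=` generated G A.
Proof. by move=> x Ax P _; apply. Qed.

Lemma generated_mono (G : groupType) (A B : set G) :
  A `<=` B -> generated G A `<=` generated G B.
Proof. by move=> AB x gx P gP BP; apply: gx => // y /AB/BP. Qed.

(** * The filtration of an analytic group *)

(** The cylinders form a base of the topology of the Baire space. *)
Lemma nbhs_baire (z : {ptws nat -> nat}) (O : set {ptws nat -> nat}) : nbhs z O ->
  exists l, forall z' : nat -> nat, (forall i, (i < l)%N -> z' i = z i) -> O z'.
Proof.
move=> Oz; apply: contrapT => H.
have /choice[u uP] : forall l, exists z' : nat -> nat,
    (forall i, (i < l)%N -> z' i = z i) /\ ~ O z'.
  move=> l; apply: contrapT => H1; apply: H; exists l => z' zz'.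
  by apply: contrapT => nO; apply: H1; exists z'.
have : {ptws, u @ \oo --> (z : nat -> nat)}.
  apply/pointwise_cvgP => t A /nbhs_singleton At.
  exists t.+1 => // n /= tn; have [un _] := uP n.
  by rewrite /= un.
move=> /(_ O Oz)[N _ NP]; have [_] := uP N; apply; exact: (NP N (leqnn N)).
Qed.

Section GroupNeighbourhoods.
Context (G : topologicalGroupType).
Implicit Types (x y : G) (O : set G).

Lemma nbhs_mulg x y O : nbhs (x * y)%g O -> exists A B,
  [/\ nbhs x A, nbhs y B & forall a b, A a -> B b -> O (a * b)%g].
Proof.
move=> /(@mulg_continuous G (x, y))[[A B] /= [Ax By] AB]; exists A, B; split=> //.
by move=> a b Aa Bb; exact: (AB (a, b)).
Qed.

Lemma nbhs_invg x O : nbhs (x^-1)%g O -> nbhs x [set y | O (y^-1)%g].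
Proof. by move=> /(@invg_continuous G x). Qed.

Lemma nbhs_mulgl x y O : nbhs (x * y)%g O -> nbhs y [set b | O (x * b)%g].
Proof.
move=> /nbhs_mulg[A [B [Ax By AB]]]; apply: filterS By => b; apply: AB.
exact: nbhs_singleton.
Qed.

Lemma nbhs_mulgr x y O : nbhs (x * y)%g O -> nbhs x [set a | O (a * y)%g].
Proof.
move=> /nbhs_mulg[A [B [Ax By AB]]]; apply: filterS Ax => a /AB; apply.
exact: nbhs_singleton.
Qed.

Lemma nbhs1_mulg O : nbhs (1%g : G) O ->
  exists2 A, nbhs (1%g : G) A & forall a b, A a -> A b -> O (a * b)%g.
Proof.
rewrite -[X in nbhs X O]mulg1 => /nbhs_mulg[A [B [A1 B1 AB]]].
by exists (A `&` B) => [|a b [Aa _] [_ Bb]]; [exact: filterI|exact: AB].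
Qed.

Lemma nbhs1_conj x O : nbhs (1%g : G) O ->
  nbhs (1%g : G) [set a | O (x^-1 * a * x)%g].
Proof.
move=> O1; apply: (@nbhs_mulgl _ _ [set b | O (b * x)%g]).
by apply: nbhs_mulgr; rewrite mulg1 mulVg.
Qed.

End GroupNeighbourhoods.

(** A decreasing base of closed neighbourhoods of the unit. *)
Definition closed_base (G : topologicalGroupType) (V : nat -> set G) : Prop :=
  [/\ forall n, closed (V n), forall n, nbhs (1%g : G) (V n),
      forall m n, (m <= n)%N -> V n `<=` V m &
      forall O, nbhs (1%g : G) O -> exists n, V n `<=` O].

Lemma metrizable_closed_base (R : realType) (G : topologicalGroupType) :
  metrizable R G -> exists V, closed_base G V.
Proof.
move=> [M [f [g [fK gK cf cg]]]].
pose B n : set M := ball (f 1%g) (n.+1%:R^-1 : R).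
have r_gt0 n : (0 < n.+1%:R^-1 :> R)%R by rewrite invr_gt0 ltr0Sn.
exists (fun n => f @^-1` closure (B n)); split.
- move=> n; apply: closed_comp; last exact: closed_closure.
  by move=> x _; exact: cf.
- move=> n; apply: cf; apply: filterS (@subset_closure _ (B n)) _.
  exact: (nbhsx_ballx (f 1%g) _ (r_gt0 n)).
- move=> m n mn x; apply: closure_subset => y; apply: le_ball.
  by rewrite lef_pV2 ?posrE ?ltr0Sn // ler_nat ltnS.
- move=> O O1; have /cg/nbhs_ballP[e /= e0 eO] : nbhs (g (f 1%g)) O by rewrite fK.
  have [n] := @ltr_add_invr R 0 (e / 2)%R ltac:(by rewrite divr_gt0).
  rewrite add0r => ne; exists n => x /= cx; rewrite -[x]fK; apply: eO.
  have [y [By xy]] := cx _ (nbhsx_ballx (f x) _ (r_gt0 n)).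
  rewrite [e]splitr; apply: (@ball_triangle _ _ y).
    exact: le_ball (ltW ne) _ By.
  by apply: le_ball (ltW ne) _ _; exact: ball_sym.
Qed.

Section Filtration.
Context (G : topologicalGroupType) (V : nat -> set G) (V_base : closed_base G V).
Context (g : nat -> G).
Context (g_dense : forall x O, nbhs (x : G) O -> exists i, O (g i)).

(** The elements [x] such that [x] and its inverse both lie in one of the first
    [k + 1] translates [g i * V n]. Asking this of the inverse as well makes the
    filtration symmetric, and takes the place of a condition on right
    translates. *)
Definition near_dense (n k : nat) : set G := [set x |
  (exists2 i, (i <= k)%N & V n ((g i)^-1 * x)%g) /\
  (exists2 i, (i <= k)%N & V n ((g i)^-1 * x^-1)%g)].

Lemma near_dense_anti (m n k : nat) (x : G) :
  (m <= n)%N -> near_dense n k x -> near_dense m k x.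
Proof.
have [_ _ Vd _] := V_base.
by move=> mn [[i ik Vi] [j jk Vj]]; split; [exists i|exists j] => //; exact: Vd Vi || exact: Vd Vj.
Qed.

Lemma near_dense_mono (n k k' : nat) (x : G) :
  (k <= k')%N -> near_dense n k x -> near_dense n k' x.
Proof.
move=> kk' [[i ik Vi] [j jk Vj]].
by split; [exists i|exists j] => //; exact: leq_trans kk'.
Qed.

Lemma dense_translate (x : G) (O : set G) : nbhs (1%g : G) O ->
  exists i, O ((g i)^-1 * x)%g.
Proof.
move=> O1; apply: (g_dense x [set y | O (y^-1 * x)%g]).
apply: (nbhs_invg _ x [set y | O (y * x)%g]).
by apply: nbhs_mulgr; rewrite mulVg.
Qed.

Lemma near_dense_cover (n : nat) (x : G) : exists k, near_dense n k x.
Proof.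
have [_ V1 _ _] := V_base.
have [i iP] := dense_translate x _ (V1 n); have [j jP] := dense_translate (x^-1)%g _ (V1 n).
by exists (maxn i j); split; [exists i|exists j] => //; rewrite ?leq_maxl ?leq_maxr.
Qed.

Lemma near_dense_closed (n k : nat) : closed (near_dense n k).
Proof.
have [Vc _ _ _] := V_base.
pose A := \bigcup_(i in `I_k.+1) [set x : G | V n ((g i)^-1 * x)%g].
have cA : closed A.
  apply: closed_bigcup => // i _; apply: (@closed_comp _ _ (fun x : G => ((g i)^-1 * x)%g)) => //.
  by move=> x _ O; exact: nbhs_mulgl.
have -> : near_dense n k = A `&` [set x | A (x^-1)%g].
  apply/seteqP; split=> x [[i ik Vi] [j jk Vj]]; split; first [by exists i|by exists j].
apply: closedI => //; apply: (@closed_comp _ _ (fun x : G => (x^-1)%g)) => //.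
by move=> x _; exact: invg_continuous.
Qed.

Lemma near_dense_filtered : filtered_group G near_dense.
Proof.
have [_ V1 Vd Vb] := V_base.
split; first by move=> n; exact: near_dense_cover.
  by move=> n k x [Kx KVx]; split=> //; rewrite invgK.
have /choice[p pP] : forall n, exists p, forall a b c,
    V p a -> V p b -> V p c -> V n (a * b * c)%g.
  move=> n; have [A A1 AV] := nbhs1_mulg _ _ (V1 n); have [B B1 BA] := nbhs1_mulg _ _ A1.
  have [q qAB] := Vb _ (filterI A1 B1); exists q => a b c /qAB[_ Ba] /qAB[_ Bb] /qAB[Ac _].
  by apply: AV => //; exact: BA.
have /choice[m mP] : forall aj : nat * nat, exists m, forall v, V m v ->
    V aj.1 ((g aj.2)^-1 * v * g aj.2)%g.
  by move=> [a j]; have [m mP] := Vb _ (nbhs1_conj _ (g j) _ (V1 a)); exists m.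
have /choice[l lP] : forall nij : nat * nat * nat, exists l,
    V (p nij.1.1) ((g l)^-1 * (g nij.1.2 * g nij.2))%g.
  by move=> [[n i] j]; exact: dense_translate (V1 _).
pose M a k := \max_(j < k.+1) m (a, j : nat).
pose C n q := \max_(i < q.+1) \max_(j < q.+1) l (n, i : nat, j : nat).
exists p, M, C => n a b k q x y pa Mb kq.
(* [x * y] is [g i * v * g j * w]; moving [v] past [g j] keeps it small. *)
have half u v : (exists2 i, (i <= q)%N & V b ((g i)^-1 * u)%g) ->
    (exists2 i, (i <= k)%N & V a ((g i)^-1 * v)%g) ->
    exists2 i, (i <= C n q)%N & V n ((g i)^-1 * (u * v))%g.
  move=> [i iq Vu] [j jk Vv]; exists (l (n, i, j)).
    have iq' : (i < q.+1)%N by [].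
    have jq' : (j < q.+1)%N by rewrite ltnS (leq_trans jk).
    apply: leq_trans (leq_bigmax_cond
      (F := fun i : 'I_q.+1 => \max_(j < q.+1) l (n, i : nat, j : nat)) (Ordinal iq') isT).
    exact: (leq_bigmax_cond (F := fun j : 'I_q.+1 => l (n, i, j : nat)) (Ordinal jq') isT).
  have -> : ((g (l (n, i, j)))^-1 * (u * v) = ((g (l (n, i, j)))^-1 * (g i * g j)) *
      ((g j)^-1 * ((g i)^-1 * u) * g j) * ((g j)^-1 * v))%g.
    by rewrite !mulgA !mulgK.
  apply: pP; first exact: (lP (n, i, j)).
    apply: (Vd _ _ pa); apply: (mP (a, j)); apply: Vd Vu; apply: leq_trans Mb.
    exact: (leq_bigmax_cond (F := fun j : 'I_k.+1 => m (a, j : nat))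
      (Ordinal (jk : j < k.+1)%N) isT).
  exact: Vd pa _ Vv.
move=> [_ xa'] [ya _] [xb _] [_ yb']; split; first exact: half.
by rewrite invgM; exact: half.
Qed.

Lemma sigma_small_sigma_bounded (B : set G) :
  sigma_small G near_dense B -> sigma_bounded B.
Proof.
have [_ V1 _ Vb] := V_base.
move=> [h hP]; exists (fun i => B `&` [set x | forall n, near_dense n (h i n) x]); last first.
  by apply/seteqP; split=> [x Bx|x [i _ []//]]; have [i Hi] := hP x Bx; exists i.
move=> i U oU U1; have nU : nbhs (1%g : G) U by exact: open_nbhs_nbhs.
have nUV : nbhs (1%g : G) [set x | U (x^-1)%g].
  by apply: nbhs_invg; rewrite invg1.
have [n VU] := Vb _ (filterI nU nUV); pose k := h i n.
exists (g @` `I_k.+1 `|` (fun j => (g j)^-1%g) @` `I_k.+1).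
  by rewrite finite_setU; split; exact: finite_image.
move=> x [_ /(_ n)[[j jk /VU[Uj _]] [j' jk' /VU[_ Uj']]]]; split.
  by exists (g j); [left; exists j|exists ((g j)^-1 * x)%g => //; rewrite mulgA mulgV mul1g].
exists (((g j')^-1 * x^-1)^-1)%g => //; exists ((g j')^-1)%g; first by right; exists j'.
by rewrite invgM !invgK mulgK.
Qed.

Lemma totally_bounded_near_dense (B : set G) (n : nat) :
  totally_bounded_set B -> exists k, B `<=` near_dense n k.
Proof.
have [_ V1 _ _] := V_base => tB.
have [A A1 AV] := nbhs1_mulg _ _ (V1 n).
have nAV : nbhs (1%g : G) [set x | A (x^-1)%g] by apply: nbhs_invg; rewrite invg1.
pose U := interior (A `&` [set x | A (x^-1)%g]).
have nU : U 1%g by exact: filterI.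
have [F /finite_seqP[s Fs] BF] := tB U (@open_interior _ _) nU.
have /choice[d dP] := fun y => dense_translate y _ A1.
pose k := \max_(y <- s) maxn (d y) (d (y^-1)%g).
have dk y : F y -> (d y <= k)%N /\ (d (y^-1)%g <= k)%N.
  rewrite Fs /= => ys.
  have := leq_bigmax_seq (P := xpredT) (F := fun y => maxn (d y) (d (y^-1)%g)) y ys isT.
  by rewrite geq_max => /andP.
exists k => x /BF[[y /dk[yk _] [u /interior_subset[Au _] <-]]].
move=> [u' /interior_subset[_ Au'] [y' /dk[_ yk'] e]]; split.
  by exists (d y) => //; rewrite mulgA; exact: AV.
by exists (d (y'^-1)%g) => //; rewrite -e invgM mulgA; exact: AV.
Qed.

Lemma sigma_bounded_sigma_small (B : set G) :
  sigma_bounded B -> sigma_small G near_dense B.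
Proof.
move=> [C tC ->].
have /choice[h hP] : forall i, exists h, forall n, C i `<=` near_dense n (h n).
  move=> i; have /choice[h hP] := fun n => totally_bounded_near_dense (C i) n (tC i).
  by exists h.
by exists h => x [i _ Cx]; exists i => n; exact: hP.
Qed.

End Filtration.

(** An analytic group has a filtration that determines its sigma-bounded sets and
    whose pullback to the Baire space is closed. *)
Lemma analytic_filtration (R : realType) (G : topologicalGroupType) : analytic R G ->
  exists (K : nat -> nat -> set G) (f : (nat -> nat) -> G),
    [/\ (forall m n k x, (m <= n)%N -> K n k x -> K m k x) /\
        (forall n k k' x, (k <= k')%N -> K n k x -> K n k' x),
        (forall n x, exists k, K n k x) /\ filtered_group G K,
        forall n k z, ~ K n k (f z) ->
          exists l, forall z', (forall i, (i < l)%N -> z' i = z i) -> ~ K n k (f z'),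
        range f = [set: G] &
        forall B, sigma_bounded B <-> sigma_small G K B].
Proof.
move=> [mG [f cf fT]]; have [V Vb] := metrizable_closed_base R G mG.
(* The images of the eventually zero sequences are dense. *)
pose g i : G := f (nth 0 (odflt [::] (unpickle i))).
have g_dense x O : nbhs (x : G) O -> exists i, O (g i).
  have : range f x by rewrite fT.
  move=> [z _ <-] /cf/nbhs_baire[l lP]; exists (pickle (mkseq z l)).
  by rewrite /g pickleK /=; apply: lP => i il; rewrite nth_mkseq.
exists (near_dense G V g), f; split=> //.
- by split; [exact: near_dense_anti|exact: near_dense_mono].
- by split; [exact: near_dense_cover|exact: near_dense_filtered].
- move=> n k z nK; have : nbhs (f z) (~` near_dense G V g n k).
    by apply: open_nbhs_nbhs; split=> //; apply: closed_openC; exact: near_dense_closed.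
  by move=> /cf/nbhs_baire.
- by move=> B; split; [exact: sigma_bounded_sigma_small|exact: sigma_small_sigma_bounded].
Qed.

(** * Chains of subgroups *)

Lemma le_mod_refl (L : set_system nat) (x : nat -> nat) : UltraFilter L -> le_mod L x x.
Proof. by move=> UL; apply: filterS filterT => n _ /=. Qed.

Lemma le_mod_trans (L : set_system nat) (x y z : nat -> nat) :
  UltraFilter L -> le_mod L x y -> le_mod L y z -> le_mod L x z.
Proof.
by move=> UL xy yz; apply: filterS (filterI xy yz) => n [/=]; exact: leq_trans.
Qed.

Lemma le_mod_total (L : set_system nat) (x y : nat -> nat) :
  UltraFilter L -> le_mod L x y \/ le_mod L y x.
Proof.
move=> UL; have [|H] := in_ultra_setVsetC [set n | (x n <= y n)%N] UL; first by left.
by right; apply: filterS H => n /= /negP; rewrite -ltnNge => /ltnW.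
Qed.

(** An injective family indexed by the cofinality is bounded on every initial
    segment: a strict initial segment is too short to be cofinal. *)
Lemma initial_segment_bounded (L : set_system nat) (b : ordinal_type)
    (d : b -> nat -> nat) : UltraFilter L -> injective d ->
  (forall (m : ordinal_type) (D : set (nat -> nat)),
    cofinal (le_mod L) D -> (D #= [set: m])%card -> ordinal_le b m) ->
  forall a, exists u, forall c, ord_rel c a -> le_mod L (d c) u.
Proof.
move=> UL d_inj b_least a; set S := [set i | ord_lt b i a].
have [u nu] : exists u, forall c, ord_lt b c a -> le_mod L (d c) u.
  have ncof : ~ cofinal (le_mod L) (d @` S).
    move=> cof; apply: (not_ordinal_le_segment b a); apply: b_least cof _.
    apply: (@card_eq_trans _ _ _ _ S); first by apply: inj_card_eq => x y _ _; exact: d_inj.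
    by rewrite card_eq_sym; exact: card_setT.
  apply: contrapT => H; apply: ncof => x; apply: contrapT => nx; apply: H; exists x => c ca.
  have [//|xd] := le_mod_total L (d c) x UL.
  by exfalso; apply: nx; exists (d c) => //; exists c.
(* The order may have a greatest element, so [a] itself is added separately. *)
exists (fun n => maxn (u n) (d a n)) => c /ord_le_ltVeq[/nu cu|->].
  by apply: (le_mod_trans L _ u) => //; apply: filterS filterT => n _ /=; exact: leq_maxl.
by apply: filterS filterT => n _ /=; exact: leq_maxr.
Qed.

Theorem corollary1p5 (R : realType) (G : topologicalGroupType)
    (hanalytic : analytic R G) (hnsb : ~ sigma_bounded [set: G])
    (L : set_system nat) (hL : nonprincipal_ultrafilter L)
    (hcoh : forall Q : set_system nat, q_point Q -> ~ coherent L Q) :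
  exists cf b : ordinal_type,
    [/\ is_cfg G cf, is_b L b & ordinal_le cf b].
Proof.
have [UL _] := hL.
have [K [f [[Ka Km] [Kc Kg] Kcl fT sbE]]] := analytic_filtration R G hanalytic.
have nsm : ~ sigma_small G K (range f) by rewrite fT => /sbE.
have [b [isb b_least]] := exists_cofinality (nat -> nat) (le_mod L) (fun x => le_mod_refl L x UL).
have [_ [D cD Db] _] := isb.
have [d [d_inj dD]] : exists d : b -> nat -> nat, injective d /\ range d = D.
  move: Db; rewrite card_eq_sym => /card_set_bijP[d [dfun dinj dsurj]].
  exists d; split; first by move=> i j; apply: dinj; rewrite inE.
  by apply/seteqP; split=> [_ [i _ <-]|y /dsurj//]; exact: dfun.
pose E := ultra_bounded L G K.
(* Generating over whole initial segments makes the chain increasing. *)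
pose H (a : b) := generated G [set x | exists2 c, ord_rel c a & E (d c) x].
have cover h : exists a, E h `<=` H a.
  have [y Dy hy] := cD h; have [a _ e] : range d y by rewrite dD.
  exists a => x Ex; apply: generated_sub; exists a; first exact: ord_refl.
  by rewrite e; exact: (ultra_bounded_mono L hL G K Km _ _ hy x Ex).
have chainH : cfg_chain H.
  split.
  - move=> a; split; first exact: generated_closed.
    move=> HT; have [u ub] := initial_segment_bounded L b d UL d_inj b_least a.
    have [h [P [Pg EP PE]]] := subgroup_ultra_bounded L hL G K Km Kg hcoh u.
    apply: (ultra_bounded_proper L hL G K Ka Km f Kcl nsm h).
    apply/seteqP; split=> // x _; apply: PE; have : H a x by rewrite HT.
    apply=> // y [c ca Ey]; apply: EP.
    exact: (ultra_bounded_mono L hL G K Km _ _ (ub c ca)).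
  - move=> i j ij; apply: generated_mono => x [c ci Ex]; exists c => //.
    exact: ord_trans ij.
  - apply/seteqP; split=> // x _; have /choice[h hP] := Kc ^~ x.
    have [a aP] := cover h; exists a => //; apply: aP.
    by apply: filterS filterT => n _ /=.
  - move=> B /sbE /(sigma_small_ultra_bounded L hL G K Km)[h Bh].
    by have [a aP] := cover h; exists a; exact: subset_trans Bh aP.
have [|cf [Hcf Hc] cf_least] := ordinal_least (fun l => exists H : l -> set G, cfg_chain H) b.
  by exists H.
exists cf, b; split=> //; last by apply: cf_least; exists H.
by split=> [|m H' cH']; [exists Hcf|apply: cf_least; exists H'].
Qed.
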